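(* Let $n,a,b$ be nonnegative integers with $b>a$ and $n\ge a+b+1$, and write $n=p(a+b+1)+q$ with integers $p\ge 1$ and $0\le q\le a+b$. If $q\in\{0,1,a+b\}$, then \[\mathrm{ex}(n,S_{a,b})=p\binom{a+b+1}{2}+\binom{q}{2},\] and the vertex-disjoint union $pK_{a+b+1}\cup K_q$ of $p$ copies of $K_{a+b+1}$ and one copy of $K_q$ is the unique (up to isomorphism) $S_{a,b}$-free graph on $n$ vertices with $\mathrm{ex}(n,S_{a,b})$ edges.
   Context: All graphs are finite, simple and undirected. For integers $a,b\ge 0$, the double star $S_{a,b}$ is the tree consisting of a central edge $uv$ together with $a$ further leaves adjacent to $u$ and $b$ further leaves adjacent to $v$. A graph is $F$-free if it contains no subgraph isomorphic to $F$; $\mathrm{ex}(n,F)$ denotes the maximum number of edges in an $F$-free graph on $n$ vertices. $K_0$ denotes the empty graph.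
   Formalization: For a=0 it is additionally assumed that b=1 or n=b+1. For a=0, b≥2, n>b+1 the claim fails: the value is wrong if q is 1 or b (C_4 for b=2, n=4); if q=0 the value holds but uniqueness fails (C_6 and 2K_3 for b=2, n=6), and that value is left out too. *)

(* Defs.v *)
From HB Require Import structures.
From mathcomp Require Import all_boot.

Set Implicit Arguments.
Unset Strict Implicit.
Unset Printing Implicit Defensive.

(* A simple graph on the vertex type T is its set of edges, each edge being a
   two-element set of vertices. *)
Record sgraph (T : finType) := SGraph {
  edges : {set {set T}};
  _ : edges \subset [set e : {set T} | #|e| == 2] }.

HB.instance Definition _ (T : finType) := [isSub for @edges T].
HB.instance Definition _ (T : finType) := [Finite of sgraph T by <:].

Definition adj (T : finType) (G : sgraph T) : rel T :=
  fun x y => [set x; y] \in edges G.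

(* The simple graph with an edge xy whenever x != y and r x y or r y x. *)
Definition rel_edges (T : finType) (r : rel T) : {set {set T}} :=
  [set [set u.1; u.2] | u : T * T & (u.1 != u.2) && r u.1 u.2].

Fact rel_edges_subproof (T : finType) (r : rel T) :
  rel_edges r \subset [set e : {set T} | #|e| == 2].
Proof.
apply/subsetP=> e /imsetP[u]; rewrite inE => /andP[neq_u _] ->.
by rewrite inE cards2 neq_u.
Qed.

Definition graph_of (T : finType) (r : rel T) : sgraph T :=
  SGraph (rel_edges_subproof r).

Definition complete_graph (T : finType) : sgraph T := graph_of (fun _ _ => true).

Definition disjoint_union (T U : finType) (G : sgraph T) (H : sgraph U) :
    sgraph (T + U)%type :=
  graph_of (fun x y => match x, y with
    | inl x', inl y' => adj G x' y'
    | inr x', inr y' => adj H x' y'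
    | _, _ => false
    end).

Definition copies (p : nat) (T : finType) (G : sgraph T) :
    sgraph ('I_p * T)%type :=
  graph_of (fun x y => (x.1 == y.1) && adj G x.2 y.2).

(* inl false and inl true are the central vertices u and v; inr (inl i) is a
   leaf at u and inr (inr j) is a leaf at v. *)
Definition double_star (a b : nat) : sgraph (bool + ('I_a + 'I_b))%type :=
  graph_of (fun x y => match x, y with
    | inl false, inl true => true
    | inl false, inr (inl _) => true
    | inl true, inr (inr _) => true
    | _, _ => false
    end).

(* Subgraphs are not required to be induced. *)
Definition contains (U T : finType) (F : sgraph U) (G : sgraph T) : bool :=
  [exists f : {ffun U -> T}, injectiveb f &&
    [forall x, forall y, adj F x y ==> adj G (f x) (f y)]].

Definition free (U T : finType) (F : sgraph U) (G : sgraph T) : bool :=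
  ~~ contains F G.

(* If no graph on n vertices is F-free (which requires F to have no edge), the
   maximum is over the empty family and this is 0. *)
Definition ex (n : nat) (U : finType) (F : sgraph U) : nat :=
  \max_(G : sgraph 'I_n | free F G) #|edges G|.

Definition isomorphic (T U : finType) (G : sgraph T) (H : sgraph U) : Prop :=
  exists2 f : T -> U, bijective f & forall x y, adj H (f x) (f y) = adj G x y.

(* Main.v *)
Require Import Defs.
From mathcomp Require Import all_boot.
From mathcomp Require Import zify.

Set Implicit Arguments.
Unset Strict Implicit.
Unset Printing Implicit Defensive.

(* Let k = a + b.  In a free graph, adjacent u and v with deg u > a and
   deg v > b satisfy |N[u] U N[v]| <= k + 1.  Hence a vertex of degree > k has
   only neighbours of degree <= a, and if such a vertex exists, charging these
   edges to their low ends gives fewer than k(n - 1)/2 edges.  Otherwise every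
   degree is at most k; a graph with the claimed number of edges has total
   deficiency sum (k - deg x) at most 0 (if q = 0) or k (if q = 1 or q = k).  A
   vertex u of degree k contains in N[u] the closed neighbourhood of each of its
   neighbours of degree > a, so, as two vertices of degree <= a would already
   have deficiency >= 2b > k, the vertices of degree k form disjoint cliques of
   size k + 1; counting modulo k + 1 shows that the other vertices are a
   clique of size q. *)

(** * Degrees, closed neighbourhoods [cnb] and the handshake identity *)

Section Basics.
Variables (T : finType) (G : sgraph T).
Implicit Types x y : T.

Definition deg x := #|[set y | adj G x y]|.
Definition cnb x := [set y | (y == x) || adj G x y].

Lemma adjC x y : adj G x y = adj G y x.
Proof. by rewrite /adj setUC. Qed.

Lemma card_edge e : e \in edges G -> #|e| = 2.
Proof.
by case: G => E /= /subsetP sE /sE; rewrite inE => /eqP.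
Qed.

Lemma adj_irr x : adj G x x = false.
Proof. by apply/negP => /card_edge; rewrite setUid cards1. Qed.

Lemma adj_neq x y : adj G x y -> x != y.
Proof. by apply: contraTneq => ->; rewrite adj_irr. Qed.

Lemma in_cnb x y : (y \in cnb x) = (y == x) || adj G x y.
Proof. by rewrite inE. Qed.

Lemma cnb_refl x : x \in cnb x.
Proof. by rewrite in_cnb eqxx. Qed.

Lemma cnbC x y : (y \in cnb x) = (x \in cnb y).
Proof. by rewrite !in_cnb eq_sym adjC. Qed.

Lemma cnb_adj x y : adj G x y -> y \in cnb x.
Proof. by rewrite in_cnb orbC => ->. Qed.

Lemma card_cnb x : #|cnb x| = (deg x).+1.
Proof.
have -> : cnb x = x |: [set y | adj G x y] by apply/setP => y; rewrite !inE.
by rewrite cardsU1 inE adj_irr.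
Qed.

Lemma deg_incident x : deg x = #|[set e in edges G | x \in e]|.
Proof.
rewrite /deg -(card_in_imset (f := fun y => [set x; y])).
  apply: eq_card => e; rewrite inE; apply/imsetP/andP => [[y]|[eG xe]].
    by rewrite inE => xy ->; rewrite !inE eqxx.
  have /eqP/cards2P[u [v [uv def_e]]] := card_edge eG; move: xe eG.
  rewrite def_e => /set2P[->|->] eG; first by exists v; rewrite ?inE.
  by exists u; [rewrite inE /adj setUC|rewrite setUC].
move=> y z; rewrite !inE => xy _ eq_xyz.
have : y \in [set x; z] by rewrite -eq_xyz !inE eqxx orbT.
by rewrite !inE eq_sym (negPf (adj_neq xy)) => /eqP.
Qed.

Lemma handshake : \sum_x deg x = 2 * #|edges G|.
Proof.
under eq_bigr => x _ do rewrite deg_incident -sum1dep_card big_mkcondr.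
rewrite exchange_big /= mulnC -sum_nat_const.
by apply: eq_bigr => e eG; rewrite -big_mkcond sum1_card card_edge.
Qed.

End Basics.

Lemma adj_graph_of (T : finType) (r : rel T) x y :
  adj (graph_of r) x y = (x != y) && (r x y || r y x).
Proof.
rewrite /adj /=; apply/imsetP/andP => [[[u v]]|[xy]].
  rewrite inE /= => /andP[uv ruv] E.
  have : #|[set x; y]| = 2 by rewrite E cards2 uv.
  rewrite cards2; case: eqP => // /eqP xy _; split=> //.
  have := set21 x y; have := set22 x y; rewrite E /=.
  case/set2P=> yE /set2P[] xE; move: xy;
    by rewrite xE yE ?eqxx // ruv ?orbT.
case/orP=> rxy; first by exists (x, y); rewrite ?inE /= ?xy.
by exists (y, x); rewrite 1?inE /= 1?eq_sym ?xy // setUC.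
Qed.

(** * Invariance under isomorphism *)

Section Transport.
Variables (T U : finType) (G : sgraph T) (H : sgraph U).

Lemma isomorphic_edges : isomorphic G H -> #|edges G| = #|edges H|.
Proof.
case=> f bij_f adjf; apply/eqP; rewrite -(eqn_pmul2l (isT : 0 < 2)).
rewrite -!handshake (reindex f) /=; last exact: onW_bij.
apply/eqP/eq_bigr => x _; rewrite /deg -(card_imset _ (bij_inj bij_f)).
apply: eq_card => y; case: bij_f => g fK gK; rewrite inE -[y]gK adjf.
by rewrite mem_imset ?inE //; apply: can_inj fK.
Qed.

Lemma isomorphic_free (W : finType) (F : sgraph W) :
  isomorphic G H -> free F H -> free F G.
Proof.
case=> f /bij_inj inj_f adjf; apply: contra => /existsP[g /andP[/injectiveP gI]].
move=> /forallP gF; apply/existsP; exists [ffun x => f (g x)]; apply/andP; split.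
  by apply/injectiveP => x y; rewrite !ffunE => /inj_f/gI.
by apply/forallP => x; apply/forallP => y; rewrite !ffunE adjf; apply: (forallP (gF x)).
Qed.

End Transport.

(** [ex] ranges over graphs on ['I_n], so the extremal graph has to be moved there. *)
Lemma isomorphic_ord (T : finType) (G : sgraph T) n :
  #|T| = n -> exists G' : sgraph 'I_n, isomorphic G' G.
Proof.
move=> <-; exists (graph_of (fun i j => adj G (enum_val i) (enum_val j))).
exists enum_val => [|i j]; first exact: enum_val_bij.
rewrite adj_graph_of [adj G (enum_val j) _]adjC orbb.
by case: eqP => //= ->; rewrite adj_irr.
Qed.

(** * Finding and excluding double stars *)

Lemma subset_card_between (T : finType) (C X : {set T}) a :
  C \subset X -> #|C| <= a <= #|X| ->
  exists A : {set T}, [/\ C \subset A, A \subset X & #|A| = a].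
Proof.
move=> CX; elim: a => [|a IHa] /andP[leCa leaX].
  exists C; split=> //; lia.
have [ltCa|] := leqP #|C| a; last by exists C; split=> //; lia.
have [|A [CA AX cardA]] := IHa; first by lia.
have /subsetPn[x xX xA] : ~~ (X \subset A).
  by apply/negP => /subset_leq_card; lia.
exists (x |: A); split; last by rewrite cardsU1 xA cardA.
  exact: subset_trans CA (subsetUr _ _).
by rewrite subUset sub1set xX.
Qed.

(** Let [A] use up [X :\: Y] first. If that suffices, [A] misses [Y]; otherwise [A] contains
    [X :\: Y], so [Y :\: A] equals [(X :|: Y) :\: A], which still has [b] elements. *)
Lemma disjoint_choice (T : finType) (X Y : {set T}) a b :
  a <= #|X| -> b <= #|Y| -> a + b <= #|X :|: Y| ->
  exists A B : {set T}, [/\ A \subset X, B \subset Y, [disjoint A & B],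
    #|A| = a & #|B| = b].
Proof.
move=> aX bY abXY.
suff [A [AX cardA bYA]] : exists A : {set T}, [/\ A \subset X, #|A| = a & b <= #|Y :\: A|].
  have [|B [_ BYA cardB]] := @subset_card_between _ set0 (Y :\: A) b (sub0set _).
    by rewrite cards0.
  exists A, B; move: BYA; rewrite subsetD disjoint_sym => /andP[-> ->]; by split.
have [le_a|lt_a] := leqP a #|X :\: Y|.
  have [|A [_ AXY cardA]] := @subset_card_between _ set0 (X :\: Y) a (sub0set _).
    by rewrite cards0.
  move: AXY; rewrite subsetD => /andP[AX dAY]; exists A; split=> //.
  by rewrite disjoint_sym in dAY; move/setDidPl: dAY => ->.
have [|A [XYA AX cardA]] := @subset_card_between _ (X :\: Y) X a (subsetDl _ _).
  by rewrite (ltnW lt_a).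
exists A; split=> //.
have -> : Y :\: A = (X :|: Y) :\: A.
  apply/setP => x; rewrite !inE; have [//|/=] := boolP (x \in A).
  by apply: contraNeq; case xY: (x \in Y); rewrite ?orbT // orbF => xX;
    apply: (subsetP XYA); rewrite !inE xY; case: (x \in X) xX.
rewrite cardsD (setIidPr _) ?cardA; first lia.
exact: subset_trans AX (subsetUl _ _).
Qed.

Section DoubleStar.
Variables (T : finType) (G : sgraph T) (a b : nat).

(** If the union were larger, there would be [a] leaves at [u] and, disjoint from them, [b] leaves
    at [v], hence a double star with central edge [uv]. *)
Lemma free_double_star_edge u v :
  free (double_star a b) G -> adj G u v -> a < deg G u -> b < deg G v ->
  #|cnb G u :|: cnb G v| <= a + b + 1.
Proof.
move=> freeG uv au bv; rewrite leqNgt; apply: contra freeG => ltab.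
pose X := [set y | adj G u y] :\ v; pose Y := [set y | adj G v y] :\ u.
have vu : adj G v u by rewrite adjC.
have cX : #|X|.+1 = deg G u by rewrite /deg (cardsD1 v [set y | _]) inE uv.
have cY : #|Y|.+1 = deg G v by rewrite /deg (cardsD1 u [set y | _]) inE vu.
(* Passing to [X] and [Y] loses only the two centres. *)
have cXY : #|cnb G u :|: cnb G v| <= #|X :|: Y| + 2.
  have -> : cnb G u :|: cnb G v = [set u; v] :|: (X :|: Y).
    apply/setP => y; rewrite !inE.
    by case: (y == u); case: (y == v); rewrite ?orbT ?andbT.
  rewrite cardsU cards2 (adj_neq uv); lia.
have [| |//|A [B [AX BY dAB cA cB]]] := @disjoint_choice _ X Y a b; try lia.
have Av i : i \in A -> (i != v) && adj G u i.
  by move/(subsetP AX); rewrite !inE.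
have Bu i : i \in B -> (i != u) && adj G v i.
  by move/(subsetP BY); rewrite !inE.
pose fA (i : 'I_a) := enum_val (cast_ord (esym cA) i).
pose fB (i : 'I_b) := enum_val (cast_ord (esym cB) i).
have fAP i : fA i \in A by apply: enum_valP.
have fBP i : fB i \in B by apply: enum_valP.
have fAI : injective fA by move=> i j /enum_val_inj/cast_ord_inj.
have fBI : injective fB by move=> i j /enum_val_inj/cast_ord_inj.
pose f (w : bool + ('I_a + 'I_b)) := match w with
  | inl c => if c then v else u
  | inr (inl i) => fA i
  | inr (inr j) => fB j end.
have fAB i j : fA i = fB j -> False.
  by move=> E; have := disjointFr dAB (fAP i); rewrite E fBP.
have fAu i : fA i <> u by move=> E; have := Av _ (fAP i); rewrite E adj_irr andbF.
have fAv i : fA i <> v by move=> E; have := Av _ (fAP i); rewrite E eqxx.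
have fBu i : fB i <> u by move=> E; have := Bu _ (fBP i); rewrite E eqxx.
have fBv i : fB i <> v by move=> E; have := Bu _ (fBP i); rewrite E adj_irr andbF.
have uNv : u <> v by apply/eqP/(adj_neq uv).
apply/existsP; exists [ffun w => f w]; apply/andP; split.
  apply/injectiveP => x y; rewrite !ffunE.
  case: x => [[]|[i|i]]; case: y => [[]|[j|j]] //= E; try by [case: (fAB _ _ E)];
    try by [case: (fAB _ _ (esym E))]; try by [rewrite (fAI _ _ E)];
    try by [rewrite (fBI _ _ E)]; case: uNv => //;
    first [case: (fAu _ E)|case: (fAv _ E)|case: (fBu _ E)|case: (fBv _ E)
      |case: (fAu _ (esym E))|case: (fAv _ (esym E))
      |case: (fBu _ (esym E))|case: (fBv _ (esym E))].
have uA i : adj G u (fA i) by case/andP: (Av _ (fAP i)).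
have vB i : adj G v (fB i) by case/andP: (Bu _ (fBP i)).
apply/forallP => x; apply/forallP => y; apply/implyP; rewrite adj_graph_of !ffunE.
by case/andP=> _; case: x => [[]|[i|i]]; case: y => [[]|[j|j]] //= _; rewrite // adjC.
Qed.

(** All [a + b + 2] vertices of a copy would lie in the closed neighbourhood of the image of one
    centre. *)
Lemma cluster_free :
  (forall x y, adj G x y -> cnb G y = cnb G x) ->
  (forall x, #|cnb G x| <= a + b + 1) -> free (double_star a b) G.
Proof.
move=> twin card_le; apply/negP => /existsP[f /andP[/injectiveP fI /forallP fP]].
have {}fP x y : adj (double_star a b) x y -> adj G (f x) (f y).
  by move=> xy; have /forallP/(_ y) := fP x; rewrite xy.
pose u : bool + ('I_a + 'I_b) := inl false; pose v : bool + ('I_a + 'I_b) := inl true.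
have uv : adj G (f u) (f v) by apply: fP; rewrite adj_graph_of.
have sub : f @: setT \subset cnb G (f u).
  apply/subsetP => _ /imsetP[w _ ->].
  case: w => [[]|[i|j]]; rewrite ?cnb_refl //; first exact: cnb_adj.
    by apply/cnb_adj/fP; rewrite adj_graph_of.
  by rewrite -(twin _ _ uv); apply/cnb_adj/fP; rewrite adj_graph_of.
have := leq_trans (subset_leq_card sub) (card_le _).
rewrite (card_imset _ fI) cardsT !card_sum card_bool !card_ord; lia.
Qed.

End DoubleStar.

(** * The extremal graph *)

Section Target.
Variables p m q : nat.

Definition cliques : sgraph ('I_p * 'I_m + 'I_q)%type :=
  disjoint_union (copies p (complete_graph 'I_m)) (complete_graph 'I_q).

Lemma adj_complete (T : finType) x y : adj (complete_graph T) x y = (x != y).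
Proof. by rewrite adj_graph_of andbT. Qed.

Lemma adj_cliques x y : adj cliques x y = (x != y) &&
  match x, y with
  | inl x', inl y' => x'.1 == y'.1
  | inr _, inr _ => true
  | _, _ => false
  end.
Proof.
rewrite adj_graph_of; case: eqP => //=; case: x => [[i j]|i]; case: y => [[i' j']|i'] xy //.
  rewrite [adj _ (i', j') _]adjC orbb adj_graph_of !adj_complete /=.
  rewrite [j' == _]eq_sym [i' == _]eq_sym orbb.
  case: (eqVneq i i') => [eqi|]; rewrite ?andbF //= andbC.
  case: (eqVneq j j') => [eqj|_]; first by case: xy; rewrite eqi eqj.
  by apply/eqP => E; apply: xy; rewrite E.
by rewrite !adj_complete orbC eq_sym orbb; apply/eqP => E; apply: xy; rewrite E.
Qed.

Lemma card_cliques : #|{: 'I_p * 'I_m + 'I_q}| = p * m + q.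
Proof. by rewrite card_sum card_prod !card_ord. Qed.

Lemma cnb_cliques x : cnb cliques x = match x with
  | inl x' => [set y | if y is inl y' then x'.1 == y'.1 else false]
  | inr _ => [set y | if y is inr _ then true else false] end.
Proof.
by case: x => [x|x]; apply/setP => -[y|y]; rewrite !inE adj_cliques;
  rewrite ?[_ == inl x]eq_sym ?[_ == inr x]eq_sym //;
  case: eqVneq => //= -[->]; rewrite eqxx.
Qed.

Lemma card_cnb_cliques x : #|cnb cliques x| = if x is inl _ then m else q.
Proof.
rewrite cnb_cliques; case: x => [[i j]|i] /=.
  have inj_i : injective (fun j : 'I_m => inl (i, j) : 'I_p * 'I_m + 'I_q) by move=> ? ? [].
  rewrite -[RHS]card_ord -cardsT -(card_imset _ inj_i); apply: eq_card => -[[i' j']|i'].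
    by rewrite inE /=; apply/eqP/imsetP => [->|[? _ [-> _]]//]; exists j'.
  by rewrite inE; apply/esym/imsetP => -[].
have inj_r : injective (fun l : 'I_q => inr l : 'I_p * 'I_m + 'I_q) by move=> ? ? [].
rewrite -[RHS]card_ord -cardsT -(card_imset _ inj_r); apply: eq_card => -[l|l]; rewrite inE.
  by apply/esym/imsetP => -[].
by rewrite imset_f.
Qed.

Lemma deg_cliques x : deg cliques x = if x is inl _ then m.-1 else q.-1.
Proof.
by have /(congr1 predn) := card_cnb_cliques x; rewrite card_cnb /= => ->; case: x.
Qed.

Lemma cnb_cliques_adj x y : adj cliques x y -> cnb cliques y = cnb cliques x.
Proof.
rewrite adj_cliques => /andP[_]; case: x => [x|x]; case: y => [y|y] //=; rewrite !cnb_cliques //.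
by move/eqP => ->.
Qed.

Lemma edges_cliques : #|edges cliques| = p * 'C(m, 2) + 'C(q, 2).
Proof.
apply/eqP; rewrite -(eqn_pmul2l (isT : 0 < 2)) -handshake big_sumType /=.
have binE k : 2 * 'C(k, 2) = k * k.-1 by rewrite -mul_bin_diag bin1.
rewrite mulnDr mulnCA !binE.
under eq_bigr do rewrite deg_cliques.
under [X in _ + X]eq_bigr do rewrite deg_cliques.
by rewrite !sum_nat_const card_prod !card_ord mulnA.
Qed.

End Target.

Lemma free_cliques a b p q :
  q <= a + b -> free (double_star a b) (cliques p (a + b + 1) q).
Proof.
move=> hq; apply: cluster_free; first exact: cnb_cliques_adj.
by move=> x; rewrite card_cnb_cliques; case: x => _; lia.
Qed.

(** * Recognising disjoint unions of cliques *)

Section Blocks.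
Variables (T : finType) (G : sgraph T) (F : {set T}) (m : nat).
Hypothesis card_F : forall u, u \in F -> #|cnb G u| = m.
Hypothesis sub_F : forall u v, u \in F -> v \in cnb G u -> cnb G v \subset cnb G u.

Definition blocks := [set cnb G u | u in F].

(** By [sub_F], [cnb G w] lies in [cnb G v]; so [u] is in [cnb G v], which therefore contains
    [cnb G u], and the sizes agree. *)
Lemma eq_cnb_meet u v w : u \in F -> v \in F -> w \in cnb G u -> w \in cnb G v ->
  cnb G u = cnb G v.
Proof.
move=> uF vF wu wv; apply/eqP; rewrite eqEcard !card_F ?leqnn ?andbT //.
by apply: sub_F => //; apply: (subsetP (sub_F vF wv)); rewrite cnbC.
Qed.

Lemma card_cover_blocks : #|cover blocks| = #|blocks| * m.
Proof.
apply: card_uniform_partition (cover blocks) _ _ => [B /imsetP[u uF ->]|]; first exact: card_F.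
apply/and3P; split=> //; last first.
  by apply/imsetP => -[u _ /setP/(_ u)]; rewrite cnb_refl inE.
apply/trivIsetP => _ _ /imsetP[u uF ->] /imsetP[v vF ->]; apply: contraNT.
by case/pred0Pn=> w /andP[/= wu wv]; rewrite (eq_cnb_meet uF vF wu wv).
Qed.

Lemma cover_blocks : (forall u v, u \in F -> v \in cnb G u -> v \in F) ->
  cover blocks = F.
Proof.
move=> closed_F; apply/setP => x; apply/bigcupP/idP => [[_ /imsetP[u uF ->]]|xF].
  exact: closed_F.
by exists (cnb G x); [apply: imset_f|apply: cnb_refl].
Qed.

End Blocks.

(** The closed neighbourhoods of vertices of [F] partition [F] into [p] cliques of size [m]; no edge
    leaves [F], and the rest is one clique. *)
Lemma isomorphic_cliques (T : finType) (G : sgraph T) (F : {set T}) p m q :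
  0 < m -> #|T| = p * m + q ->
  (forall u, u \in F -> #|cnb G u| = m) ->
  (forall u v, u \in F -> v \in cnb G u -> v \in F) ->
  (forall u v, u \in F -> v \in cnb G u -> cnb G v \subset cnb G u) ->
  #|~: F| = q ->
  (forall x y, x \notin F -> y \notin F -> x != y -> adj G x y) ->
  isomorphic G (cliques p m q).
Proof.
move=> m_gt0 cardT card_F closed_F sub_F cardFC cliqueFC.
have coverF := cover_blocks closed_F.
have card_blocks : #|blocks G F| = p.
  have := card_cover_blocks card_F sub_F; rewrite coverF.
  have := cardsC F; rewrite cardFC cardT => /addIn -> /eqP.
  by rewrite eqn_pmul2r // eq_sym => /eqP.
(* [P x y] prescribes the image of [x]: the number of its block and its position there, or its
   position in the complement of [F]. *)
pose P x (y : 'I_p * 'I_m + 'I_q) := match y with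
  | inl ij => [&& x \in F, index (cnb G x) (enum (blocks G F)) == ij.1
                         & index x (enum (cnb G x)) == ij.2]
  | inr l => (x \notin F) && (index x (enum (~: F)) == l)
  end.
have [f fP] : exists f, forall x, P x (f x).
  apply: (fin_all_exists (P := P)) => x; have [xF|xF] := boolP (x \in F).
    have ltp : index (cnb G x) (enum (blocks G F)) < p.
      by rewrite -card_blocks cardE index_mem mem_enum imset_f.
    have ltm : index x (enum (cnb G x)) < m.
      by rewrite -(card_F x xF) cardE index_mem mem_enum cnb_refl.
    by exists (inl (Ordinal ltp, Ordinal ltm)); rewrite /P xF !eqxx.
  have ltq : index x (enum (~: F)) < q.
    by rewrite -cardFC cardE index_mem mem_enum inE.
  by exists (inr (Ordinal ltq)); rewrite /P xF eqxx.
have blockE x y : x \in F -> y \in F ->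
  index (cnb G x) (enum (blocks G F)) = index (cnb G y) (enum (blocks G F)) ->
  cnb G x = cnb G y.
  by move=> xF yF /(index_inj (cnb G x)); apply; rewrite ?mem_enum; apply: imset_f.
have fI : injective f.
  move=> x y fxy; have := fP x; have := fP y; rewrite fxy /P.
  case: (f y) => [[i j]|l] /=.
    case/and3P=> yF /eqP yi /eqP yj /and3P[xF /eqP xi /eqP xj].
    have E : cnb G x = cnb G y by apply: blockE; rewrite ?xi.
    by move: xj; rewrite E -yj => /(index_inj x); apply; rewrite mem_enum ?cnb_refl // -E cnb_refl.
  case/andP=> yF /eqP yl /andP[xF /eqP]; rewrite -yl => /(index_inj x).
  by apply; rewrite mem_enum inE.
exists f; first by apply: inj_card_bij => //; rewrite card_cliques cardT.
move=> x y; rewrite adj_cliques (inj_eq fI).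
have [->|xy] := eqVneq x y; first by rewrite adj_irr.
have := fP x; have := fP y; rewrite /P /=.
case: (f x) => [[i j]|l]; case: (f y) => [[i' j']|l'] /=.
- case/and3P=> yF /eqP yi _ /and3P[xF /eqP xi _].
  apply/eqP/idP => [eqi|/cnb_adj yx].
    have E : cnb G x = cnb G y by apply: blockE; rewrite ?xi ?eqi.
    have := cnb_refl G y; rewrite -E in_cnb eq_sym.
    by rewrite (negPf xy).
  apply/val_inj; rewrite /= -xi -yi.
  by rewrite (eq_cnb_meet card_F sub_F xF yF yx (cnb_refl G y)).
- case/andP=> yF _ /and3P[xF _ _]; apply/esym/negP => /cnb_adj/(closed_F _ _ xF).
  by rewrite (negPf yF).
- case/and3P=> yF _ _ /andP[xF _]; apply/esym/negP; rewrite adjC => /cnb_adj/(closed_F _ _ yF).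
  by rewrite (negPf xF).
by case/andP=> yF _ /andP[xF _]; rewrite cliqueFC.
Qed.

(** * Graphs with a vertex of degree above [a + b] *)

Lemma degE (T : finType) (G : sgraph T) x : deg G x = \sum_y adj G x y.
Proof. by rewrite /deg -sum1dep_card big_mkcond. Qed.

(** Charging the edges at high vertices to their low ends at most doubles a low degree, to
    [2 * a < a + b]. Each low vertex thus has one unit to spare, and [h] alone has more than [a + b]
    low neighbours. *)
Lemma sum_deg_high (T : finType) (G : sgraph T) a b h :
  a < b -> free (double_star a b) G -> a + b < deg G h ->
  \sum_x deg G x + (a + b) < (a + b) * #|T|.
Proof.
move=> lt_ab freeG high_h.
have high_low x y : a + b < deg G x -> adj G x y -> deg G y <= a.
  move=> high_x xy; rewrite leqNgt; apply/negP => low_y; rewrite adjC in xy.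
  have ltb : b < deg G x by lia.
  have := leq_trans (subset_leq_card (subsetUr _ _)) (free_double_star_edge freeG xy low_y ltb).
  by rewrite card_cnb; lia.
pose H := [set x | a + b < deg G x]; pose L := [set x | deg G x <= a].
pose w y := \sum_(x in H) adj G x y.
have w_le y : w y <= deg G y.
  rewrite degE /w big_mkcond; apply: leq_sum => x _.
  by rewrite [adj G y x]adjC; case: ifP.
have w0 y : a < deg G y -> w y = 0.
  move=> low_y; rewrite /w big1 // => x; rewrite inE => xH.
  by case xy: (adj G x y) => //; have := high_low _ _ xH xy; lia.
have sum_w : \sum_(x in H) deg G x = \sum_y w y.
  by rewrite exchange_big; apply: eq_bigr => x _; rewrite degE.
(* Pointwise, a high vertex contributes 0, a low one at most [2 * a + 1 <= a + b], and any other its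
   degree. *)
have sum_le : \sum_x ((if x \in H then 0 else deg G x) + w x + (x \in L)) <= \sum_(x : T) (a + b).
  apply: leq_sum => x _; rewrite !inE; have := w_le x; have := @w0 x.
  by case: ltnP => ?; case: leqP => //= *; lia.
rewrite sum_nat_const !big_split /= -sum_w in sum_le.
have cardL : a + b < #|L|.
  rewrite (leq_trans high_h) //; apply: subset_leq_card.
  by apply/subsetP => y; rewrite !inE; apply: high_low.
have sumL : \sum_x (x \in L : nat) = #|L|.
  by rewrite -sum1_card [RHS]big_mkcond; apply: eq_bigr => x _; case: (x \in L).
have sumH : \sum_x deg G x = \sum_x (if x \in H then 0 else deg G x) + \sum_(x in H) deg G x.
  rewrite [X in _ = _ + X]big_mkcond -big_split; apply: eq_bigr => x _.
  by case: (x \in H) => /=; rewrite ?addn0.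
by rewrite sumH mulnC; apply: leq_trans sum_le; rewrite sumL ltn_add2l.
Qed.

(** * Counting deficiencies when all degrees are at most [a + b] *)

Lemma eq_remainder m c r p q :
  c * m + r = p * m + q -> r < m -> q < m -> r = q.
Proof.
by move=> /(congr1 (modn^~ m)) E rm qm; move: E; rewrite !modnMDl !modn_small.
Qed.

Section Deficiency.
Variables (T : finType) (G : sgraph T) (a b p q : nat).
Hypothesis lt_ab : a < b.
Hypothesis card_T : #|T| = p * (a + b + 1) + q.
Hypothesis le_q : q <= a + b.
Hypothesis q_cases : q = 0 \/ q = 1 \/ q = a + b.
Hypothesis deg_le : forall x, deg G x <= a + b.
(** Together with [deg_le], this is what the section retains of freeness. *)
Hypothesis full_sub : forall u v, deg G u = a + b -> adj G u v -> a < deg G v ->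
  cnb G v \subset cnb G u.
(** The bound is the deficiency [q * (a + b + 1 - q)] of the target graph, evaluated at the three
    values of [q]. *)
Hypothesis deficiency_le : \sum_x (a + b - deg G x) <= if q == 0 then 0 else a + b.

Let full := [set u | deg G u == a + b].

Let card_full u : u \in full -> #|cnb G u| = a + b + 1.
Proof. by rewrite inE card_cnb addn1 => /eqP->. Qed.

Let full_cnb u v : u \in full -> v \in cnb G u -> a < deg G v ->
  cnb G v \subset cnb G u.
Proof.
by rewrite inE in_cnb => /eqP du /orP[/eqP->|uv] // dv; apply: full_sub.
Qed.

Let deficiency_ge (A : {set T}) :
  \sum_(x in A) (a + b - deg G x) <= if q == 0 then 0 else a + b.
Proof.
apply: leq_trans deficiency_le; rewrite [leqRHS](bigID (mem A)) /=; exact: leq_addr.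
Qed.

Let card_nonfull (A : {set T}) : A \subset ~: full ->
  #|A| <= \sum_(x in A) (a + b - deg G x).
Proof.
move=> /subsetP Afull; rewrite -sum1_card; apply: leq_sum => x /Afull.
by rewrite !inE; have := deg_le x; lia.
Qed.

(** The deficiency of [z] leaves so little for the rest that [z] must be isolated and all other
    vertices full. *)
Lemma isomorphic_cliques_low z : deg G z <= a ->
  isomorphic G (cliques p (a + b + 1) q).
Proof.
move=> low_z.
pose S := [set x | (x != z) && (x \notin full)].
have S_nonfull (A : {set T}) : A \subset S -> A \subset ~: full.
  by move=> /subsetP AS; apply/subsetP => x /AS; rewrite !inE => /andP[].
have zNS : z \notin S by rewrite inE eqxx.
(* After [z] is paid for, at most [deg G z] remains for [S], whose members cost at least 1 each. *)
have defS : a + b - deg G z + \sum_(x in S) (a + b - deg G x) <= a + b.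
  by have := deficiency_ge (z |: S); rewrite big_setU1 // => /leq_trans; apply; case: ifP.
have defSw w : w \in S -> a + b - deg G z + (a + b - deg G w) + #|S|.-1 <= a + b.
  move=> wS; move: defS; rewrite (big_setD1 w) //= (cardsD1 w) wS.
  by have := card_nonfull (S_nonfull _ (subsetDl S [set w])); lia.
(* Two vertices of degree at most [a] would cost [2 * b > a + b]. *)
have low_uniq x : x != z -> a < deg G x.
  move=> xz; rewrite ltnNge; apply/negP => low_x.
  have /defSw : x \in S by rewrite !inE xz; lia.
  lia.
have cardS : #|S| <= deg G z.
  by have := card_nonfull (S_nonfull _ (subxx S)); have := deg_le z; lia.
have q_gt0 : 0 < q.
  have := deficiency_ge [set z]; rewrite big_set1; case: eqP; lia.
have deg_z : deg G z = 0.
  apply/eqP; rewrite -leqn0 leqNgt; apply/negP => dz_gt0.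
  (* A full [w] in [cnb G u] has [cnb G w = cnb G u], so it is adjacent to [z]. Hence [cnb G u] is
     covered by [cnb G z] and [S], giving [a + b + 1 <= 2 * deg G z + 1 <= 2 * a + 1], which is
     impossible. *)
  have nbr_nonfull u : u \in full -> adj G u z -> False.
    move=> uF uz.
    have sub : cnb G u :\: cnb G z \subset S.
      apply/subsetP => w /setDP[wu wz]; rewrite inE.
      have wNz : w != z by apply: contraNneq wz => ->; apply: cnb_refl.
      rewrite wNz; apply: contraNN wz => wF; rewrite cnbC.
      have /eqP -> : cnb G w == cnb G u.
        by rewrite eqEcard (full_cnb uF wu (low_uniq _ wNz)) !card_full ?leqnn.
      exact: cnb_adj.
    have := leq_trans (subset_leq_card sub) cardS.
    have := cardsID (cnb G z) (cnb G u).
    have := subset_leq_card (subsetIr (cnb G u) (cnb G z)).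
    rewrite (card_full uF) card_cnb; lia.
  have nbrS : [set y | adj G z y] = S.
    apply/eqP; rewrite eqEcard cardS andbT; apply/subsetP => y; rewrite !inE => zy.
    rewrite eq_sym (adj_neq zy) /=; apply/negP => yF.
    by apply: (@nbr_nonfull y); rewrite ?inE // adjC.
  have /card_gt0P[w] := dz_gt0; rewrite nbrS => wS.
  have zw : adj G z w by move: wS; rewrite -nbrS inE.
  have dw : a < deg G w by apply: low_uniq; rewrite eq_sym (adj_neq zw).
  (* A vertex [x] of [cnb G w] outside [cnb G z] would be full, so [cnb G w] would lie in [cnb G x]
     and [z] be adjacent to [x]. The inclusion yields [deg G w <= deg G z <= a], against [dw]. *)
  have sub : cnb G w \subset cnb G z.
    apply/subsetP => x xw; apply/negPn/negP => xz.
    have xF : x \in full.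
      apply: contraNT xz => xF; rewrite in_cnb; case: eqP => //= /eqP xz.
      by have : x \in S; [rewrite inE xz|rewrite -nbrS inE].
    rewrite cnbC in xw; have /subsetP/(_ z) := full_cnb xF xw dw.
    by rewrite cnbC cnb_adj // cnbC (negPf xz) => /(_ isT).
  have := subset_leq_card sub; rewrite !card_cnb.
  have := defSw _ wS; rewrite -nbrS -/(deg G z); have := deg_le z; lia.
have fullE : ~: full = [set z].
  have /eqP S0 : S == set0 by rewrite -cards_eq0 -leqn0 -deg_z.
  apply/setP => x; have := in_set0 x; rewrite -S0 !inE; case: eqP => [-> _|_ /= ->//].
  by rewrite deg_z; lia.
have fullP x : (x \in full) = (x != z).
  by rewrite -[full]setCK fullE !inE.
have closed_full u v : u \in full -> v \in cnb G u -> v \in full.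
  rewrite !fullP => uz; apply: contraTneq => ->; rewrite cnbC.
  have /eqP : #|cnb G z| = 1 by rewrite card_cnb deg_z.
  by case/cards1P=> y cnbz; have := cnb_refl G z; rewrite cnbz !inE => /eqP <-.
have sub_full u v : u \in full -> v \in cnb G u -> cnb G v \subset cnb G u.
  by move=> uF vu; apply: full_cnb => //; apply: low_uniq; rewrite -fullP (closed_full u).
apply: (isomorphic_cliques (F := full)) => //; first by rewrite addn1.
  have := cardsC full; rewrite fullE -(cover_blocks closed_full).
  by rewrite (card_cover_blocks card_full sub_full) cards1 card_T => /eq_remainder; apply; lia.
by move=> x y; rewrite !fullP !negbK => /eqP -> /eqP ->; rewrite eqxx.
Qed.

Lemma isomorphic_cliques_deficiency : isomorphic G (cliques p (a + b + 1) q).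
Proof.
have [/existsP[z]|/existsPn no_low] := boolP [exists z, deg G z <= a].
  exact: isomorphic_cliques_low.
have {}no_low x : a < deg G x by rewrite ltnNge.
have sub_full u v : u \in full -> v \in cnb G u -> cnb G v \subset cnb G u.
  by move=> uF vu; apply: full_cnb.
pose W := cover (blocks G full).
have full_W : full \subset W.
  apply/subsetP => u uF; apply/bigcupP.
  by exists (cnb G u); [apply: imset_f|apply: cnb_refl].
have closed_W x y : x \in W -> y \in cnb G x -> y \in W.
  case/bigcupP=> _ /imsetP[u uF ->] xu yx; apply/bigcupP.
  exists (cnb G u); first exact: imset_f.
  exact: (subsetP (sub_full _ _ uF xu)).
have closed_WC x y : x \notin W -> y \in cnb G x -> y \notin W.
  by move=> xW yx; apply: contra xW => yW; apply: closed_W yW _; rewrite cnbC.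
have card_WF : #|~: W| <= #|~: full| by rewrite subset_leq_card // setCS.
have card_F := leq_trans (card_nonfull (subxx _)) (deficiency_ge (~: full)).
(* At most [a + b] vertices lie outside [W], a disjoint union of blocks of size [a + b + 1], so
   their number is the remainder [q]. *)
have card_W : #|~: W| = q.
  have := cardsC W; rewrite (card_cover_blocks card_full sub_full) card_T.
  by move/eq_remainder; apply; case: ifP card_F; lia.
(* If [q = 1], the vertex outside [W] would be isolated, contrary to [no_low]. Otherwise the
   deficiency bound equals [q], which forces [W = full]. *)
have [q1|q0k] : q = 1 \/ (if q == 0 then 0 else a + b) = q.
  by case: q_cases => [->|[->|qE]]; [right|left|right; case: eqP qE; lia].
  have /eqP/cards1P[z Wz] : #|~: W| = 1 by rewrite card_W.
  have zW : z \notin W by rewrite -in_setC Wz inE.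
  have : cnb G z \subset ~: W by apply/subsetP => y; rewrite in_setC; apply: closed_WC.
  move/subset_leq_card; rewrite card_cnb card_W; have := no_low z; lia.
have WE : W = full.
  apply/eqP; rewrite eq_sym -(inj_eq (@setC_inj T)) eq_sym eqEcard setCS full_W /=.
  by rewrite card_W -q0k.
rewrite WE in closed_W closed_WC card_W card_WF.
apply: (isomorphic_cliques (F := full)) => //; first by rewrite addn1.
move=> x y xF yF xy.
(* The other [q - 1] nonfull vertices cost at least 1 each, leaving at most 1 for [x]; so
   [deg G x >= a + b - 1 >= q - 1]. *)
have defx : #|~: full| <= #|cnb G x|.
  have := deficiency_ge (~: full); rewrite q0k (big_setD1 x) ?in_setC //=.
  have := card_nonfull (subsetDl (~: full) [set x]).
  have := cardsD1 x (~: full); rewrite in_setC xF card_W card_cnb.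
  lia.
have /eqP cnbx : cnb G x == ~: full.
  by rewrite eqEcard defx andbT; apply/subsetP => w wx; rewrite in_setC (closed_WC x).
have : y \in cnb G x by rewrite cnbx in_setC.
by rewrite in_cnb eq_sym (negPf xy).
Qed.

End Deficiency.

(** * From the edge count to the structure and the extremal number *)

Lemma free_isomorphic_cliques (T : finType) (G : sgraph T) n a b p q :
  a < b -> q <= a + b -> n = p * (a + b + 1) + q ->
  (a = 0 -> b = 1 \/ n = b + 1) -> q = 0 \/ q = 1 \/ q = a + b ->
  #|T| = n -> free (double_star a b) G ->
  #|edges (cliques p (a + b + 1) q)| <= #|edges G| ->
  isomorphic G (cliques p (a + b + 1) q).
Proof.
move=> lt_ab le_q nE a0 q_cases card_T freeG le_edges.
(* This is the deficiency bound without subtraction; the target graph attains equality. *)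
have sum_ge : (a + b) * n <= \sum_x deg G x + if q == 0 then 0 else a + b.
  rewrite handshake.
  apply: (@leq_trans (2 * #|edges (cliques p (a + b + 1) q)|
                      + if q == 0 then 0 else a + b)).
    rewrite edges_cliques mulnDr mulnCA -!mul_bin_diag !bin1 nE.
    case: q_cases => [->|[->|->]]; case: eqP; nia.
  by rewrite leq_add2r leq_mul2l.
have deg_le x : deg G x <= a + b.
  rewrite leqNgt; apply/negP => high_x.
  have := sum_deg_high lt_ab freeG high_x; rewrite card_T.
  by case: ifP sum_ge; lia.
apply: isomorphic_cliques_deficiency => //; first by rewrite card_T.
  move=> u v du uv dv.
  (* For [a = 0], [deg G u = b] is too small for [free_double_star_edge]. Instead, either all
     degrees are at most 1, or [u] is adjacent to every other vertex. *)
  have [a_eq0|a_gt0] := posnP a.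
    case: (a0 a_eq0) => [b1|nb].
      have /eqP <- : [set u; v] == cnb G v.
        rewrite eqEcard subUset !sub1set cnb_refl cnbC cnb_adj // cards2 (adj_neq uv) card_cnb.
        by have := deg_le v; lia.
      by rewrite subUset !sub1set cnb_refl cnb_adj.
    have /eqP -> : cnb G u == setT by rewrite eqEcard subsetT cardsT card_T card_cnb; lia.
    exact: subsetT.
  rewrite adjC in uv.
  have ltb : b < deg G u by lia.
  have card_le := free_double_star_edge freeG uv dv ltb.
  (* [cnb G u] already has [a + b + 1] elements, so the union adds nothing. *)
  have /eqP -> : cnb G u == cnb G v :|: cnb G u.
    by rewrite eqEcard subsetUr card_cnb; lia.
  exact: subsetUl.
have : \sum_x (a + b - deg G x) + \sum_x deg G x = (a + b) * n.
  rewrite -big_split /= (eq_bigr (fun=> a + b)) => [|x _]; last by rewrite subnK.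
  by rewrite sum_nat_const card_T mulnC.
lia.
Qed.

(* For a = 0 the double star is the star with b + 1 leaves, and the claim holds
   exactly when b = 1 or n = b + 1: otherwise the cycle on n vertices (b = 2),
   and more generally (nearly) b-regular graphs, are further or better examples.
   The hypothesis ha excludes exactly these cases. *)
Theorem theorem5p1 (n a b p q : nat)
  (hab : a < b) (hn : a + b + 1 <= n)
  (hp : 1 <= p) (hq : q <= a + b) (hnpq : n = p * (a + b + 1) + q)
  (ha : a = 0 -> b = 1 \/ n = b + 1)
  (hq3 : q = 0 \/ q = 1 \/ q = a + b) :
  ex n (double_star a b) = p * 'C(a + b + 1, 2) + 'C(q, 2) /\
  (forall (T : finType) (G : sgraph T), #|T| = n ->
     (free (double_star a b) G /\ #|edges G| = ex n (double_star a b)) <->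
     isomorphic G (disjoint_union (copies p (complete_graph 'I_(a + b + 1)))
                                  (complete_graph 'I_q))).
Proof.
have iso := free_isomorphic_cliques hab hq hnpq ha hq3.
have exE : ex n (double_star a b) = #|edges (cliques p (a + b + 1) q)|.
  apply/eqP; rewrite eqn_leq; apply/andP; split.
    (* A free graph with more edges than the target would, by [iso], be isomorphic to it. *)
    apply/bigmax_leqP => G freeG; rewrite leqNgt; apply/negP => lt_edges.
    have E := isomorphic_edges (iso _ _ (card_ord n) freeG (ltnW lt_edges)).
    by rewrite E ltnn in lt_edges.
  have card_n : #|{: 'I_p * 'I_(a + b + 1) + 'I_q}| = n by rewrite card_cliques.
  have [G isoG] := isomorphic_ord (cliques p (a + b + 1) q) card_n.
  rewrite -(isomorphic_edges isoG).
  by apply: leq_bigmax_cond; apply: isomorphic_free isoG (free_cliques _ hq).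
split; first by rewrite exE edges_cliques.
move=> T G card_T; rewrite exE; split=> [[freeG edgesG]|isoG].
  by apply: iso => //; rewrite edgesG.
by split; [apply: isomorphic_free isoG (free_cliques _ hq)|apply: isomorphic_edges].
Qed.
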